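(* Let $q\in\mathbb{C}^*$ be generic (not a root of unity). A PBW basis (in particular a $\mathbb{C}$-vector space basis) for the moduli algebra $A_{\Sigma_{0,4}}$ of the four-punctured sphere is $$\{(a^1_1)^{\alpha_1}(a^1_2)^{\beta_1}(a^2_1)^{\gamma_1}(a^2_2)^{\delta_1}(b^1_1)^{\alpha_2}(b^1_2)^{\beta_2}(b^2_1)^{\gamma_2}(b^2_2)^{\delta_2}(c^1_1)^{\alpha_3}(c^1_2)^{\beta_3}(c^2_1)^{\gamma_3}(c^2_2)^{\delta_3}\mid\alpha_i,\beta_i,\gamma_i,\delta_i\in\mathbb{N}_0,\ \beta_i=0\text{ or }\gamma_i=0\text{ for each }i=1,2,3\}.$$
   Context: All tensor indices range over $\{1,2\}$. $A_{\Sigma_{0,4}}$ is the $\mathbb{C}$-algebra with generators $a^i_j,b^i_j,c^i_j$ and the following relations. (1) For each letter $x\in\{a,b,c\}$: $x^1_2x^1_1=x^1_1x^1_2+(1-q^{-2})x^1_2x^2_2$; $x^2_1x^1_1=x^1_1x^2_1-q^{-2}(1-q^{-2})x^2_1x^2_2$; $x^2_1x^1_2=x^1_2x^2_1+(1-q^{-2})(x^1_1x^2_2-x^2_2x^2_2)$; $x^2_2x^1_1=x^1_1x^2_2$; $x^2_2x^1_2=q^2x^1_2x^2_2$; $x^2_2x^2_1=q^{-2}x^2_1x^2_2$; $x^1_1x^2_2=1+q^2x^1_2x^2_1$. (2) For letters $x<y$ ($a<b<c$): $y^e_fx^g_h=\sum_{i,j,k,l,m,n,o,p}\tilde R^{ig}_{fj}R^{ej}_{kl}R^{mn}_{ih}(R^{-1})^{ko}_{pn}\,x^l_oy^p_m$,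 where the nonzero entries are $R^{11}_{11}=R^{22}_{22}=q^{1/2}q$, $R^{12}_{12}=R^{21}_{21}=q^{1/2}$, $R^{21}_{12}=q^{1/2}(q-q^{-1})$; $(R^{-1})^{11}_{11}=(R^{-1})^{22}_{22}=q^{-1/2}q^{-1}$, $(R^{-1})^{12}_{12}=(R^{-1})^{21}_{21}=q^{-1/2}$, $(R^{-1})^{21}_{12}=-q^{-1/2}(q-q^{-1})$; $\tilde R^{11}_{11}=\tilde R^{22}_{22}=q^{-1/2}q^{-1}$, $\tilde R^{12}_{12}=\tilde R^{21}_{21}=q^{-1/2}$, $\tilde R^{21}_{12}=q^{-1/2}q^{-2}(q^{-1}-q)$. Equivalently, $A_{\Sigma_{0,4}}$ is the braided tensor product of three copies of the algebra defined by the relations (1) for a single letter, with vector space $\mathcal{O}_q(\mathrm{SL}_2)^{\otimes3}$. *)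

(* Defs.v *)
From HB Require Import structures.
From mathcomp Require Import all_boot all_order all_algebra.
From mathcomp Require Import finmap.
From mathcomp Require Import boolp reals.
From mathcomp Require Import complex.
From mathcomp.multinomials Require Import monalg.

Set Implicit Arguments.
Unset Strict Implicit.
Unset Printing Implicit Defensive.

Import Order.TTheory GRing.Theory Num.Theory.
Local Open Scope ring_scope.
Local Open Scope quotient_scope.

(* The free unital associative K-algebra on X: the monoid algebra over K of the
   free monoid on X. *)
Definition free_algebra (K : comNzRingType) (X : choiceType) : Type :=
  {malg K[{fmonom X}]}.

Section FreeAlgebra.
Variables (K : comNzRingType) (X : choiceType).

HB.instance Definition _ := GRing.Lalgebra.on (free_algebra K X).

Fact free_scalerAr (k : K) (x y : free_algebra K X) :
  k *: (x * y) = x * (k *: y).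
Proof.
have ZE (c : K) (g : {malg K[{fmonom X}]}) : c *: g = \sum_(m <- msupp g)
    << c * mcoeff m g *g m >> by [].
have XE (g h : {malg K[{fmonom X}]}) :
  g * h = \sum_(m <- msupp g) \sum_(m' <- msupp h)
    << mcoeff m g * mcoeff m' h *g mmul m m' >> by [].
have -> : x * (k *: y) = \sum_(m <- msupp x) \sum_(m' <- msupp y)
    << mcoeff m x * (k * mcoeff m' y) *g mmul m m' >>.
  rewrite [LHS](fgmullw (fsubset_refl _) (msuppZ_le k y)).
  by apply: eq_bigr => m _; apply: eq_bigr => m' _; rewrite mcoeffZ.
rewrite XE scaler_sumr; apply: eq_bigr => m _.
rewrite scaler_sumr; apply: eq_bigr => m' _.
apply/malgP => w; rewrite mcoeffZ !mcoeffU mulrnAr.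
by rewrite mulrCA.
Qed.

HB.instance Definition _ :=
  GRing.Lalgebra_isAlgebra.Build K (free_algebra K X) free_scalerAr.

Definition free_gen (x : X) : free_algebra K X := << fmu x >>.

End FreeAlgebra.

(* The quotient of an algebra F by relations u = v, for all u v with rel u v.
   The quotient may be trivial, and algType requires 1 != 0, so it only gets a
   pzRingType and an lmodType structure, related by quot_scalerAl and
   quot_scalerAr. *)
Section QuotientAlgebra.
Variables (K : comNzRingType) (F : algType K) (rel : F -> F -> Prop).

Inductive ideal_gen : F -> Prop :=
| ideal_rel u v : rel u v -> ideal_gen (u - v)
| ideal_0 : ideal_gen 0
| ideal_add u v : ideal_gen u -> ideal_gen v -> ideal_gen (u + v)
| ideal_mull a u : ideal_gen u -> ideal_gen (a * u)
| ideal_mulr u a : ideal_gen u -> ideal_gen (u * a).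

Definition ideal_pred : F -> bool := fun u => `[< ideal_gen u >].

Fact ideal_pred_zmod_closed : zmod_closed ideal_pred.
Proof.
split=> [|u v]; first exact/asboolP/ideal_0.
move=> /asboolP Iu /asboolP Iv; apply/asboolP/ideal_add => //.
by rewrite -mulN1r; apply: ideal_mull.
Qed.

HB.instance Definition _ :=
  GRing.isZmodClosed.Build F ideal_pred ideal_pred_zmod_closed.

Definition ideal_zmod : zmodClosed F := GRing.ZmodClosed.clone F ideal_pred _.

Definition quot_algebra : Type := Quotient.quot ideal_zmod.

HB.instance Definition _ := GRing.Zmodule.on quot_algebra.

Definition quot_proj (u : F) : quot_algebra := \pi_(Quotient.quot ideal_zmod) u.

Lemma quot_projK (x : quot_algebra) : quot_proj (repr x) = x.
Proof. exact: reprK. Qed.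

Lemma quot_projP (u v : F) : quot_proj u = quot_proj v <-> ideal_gen (u - v).
Proof.
rewrite /quot_proj; split=> [/eqP|Iuv].
  by rewrite -Quotient.idealrBE => /asboolP.
by apply/eqP; rewrite -Quotient.idealrBE; apply/asboolP.
Qed.

Lemma quot_projB : zmod_morphism quot_proj.
Proof. exact: pi_is_zmod_morphism. Qed.

HB.instance Definition _ :=
  GRing.isZmodMorphism.Build F quot_algebra quot_proj quot_projB.

Definition quot_one : quot_algebra := quot_proj 1.
Definition quot_mul (x y : quot_algebra) : quot_algebra :=
  quot_proj (repr x * repr y).
Definition quot_scale (k : K) (x : quot_algebra) : quot_algebra :=
  quot_proj (k *: repr x).

Lemma quot_mulE u v : quot_mul (quot_proj u) (quot_proj v) = quot_proj (u * v).
Proof.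
have I w : ideal_gen (repr (quot_proj w) - w).
  by apply/quot_projP; rewrite quot_projK.
apply/quot_projP.
rewrite -(subrK (u * repr (quot_proj v)) (_ * _)) -addrA -mulrBl -mulrBr.
by apply: ideal_add; [apply: ideal_mulr | apply: ideal_mull].
Qed.

Lemma quot_scaleE k u : quot_scale k (quot_proj u) = quot_proj (k *: u).
Proof.
apply/quot_projP; rewrite -scalerBr -[_ - u]mul1r scalerAl.
by apply/ideal_mull/quot_projP; rewrite quot_projK.
Qed.

Let projE := (quot_mulE, quot_scaleE, =^~ raddfD quot_proj).

Fact quot_mulA : associative quot_mul.
Proof.
move=> x y z; rewrite -[x]quot_projK -[y]quot_projK -[z]quot_projK.
by rewrite !projE mulrA.
Qed.
Fact quot_mul1r : left_id quot_one quot_mul.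
Proof. by move=> x; rewrite -[x]quot_projK projE mul1r. Qed.
Fact quot_mulr1 : right_id quot_one quot_mul.
Proof. by move=> x; rewrite -[x]quot_projK projE mulr1. Qed.
Fact quot_mulDl : left_distributive quot_mul +%R.
Proof.
move=> x y z; rewrite -[x]quot_projK -[y]quot_projK -[z]quot_projK.
by rewrite !projE mulrDl.
Qed.
Fact quot_mulDr : right_distributive quot_mul +%R.
Proof.
move=> x y z; rewrite -[x]quot_projK -[y]quot_projK -[z]quot_projK.
by rewrite !projE mulrDr.
Qed.

HB.instance Definition _ := GRing.Zmodule_isPzRing.Build quot_algebra
  quot_mulA quot_mul1r quot_mulr1 quot_mulDl quot_mulDr.

Fact quot_scaleA a b x : quot_scale a (quot_scale b x) = quot_scale (a * b) x.
Proof. by rewrite -[x]quot_projK !projE scalerA. Qed.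
Fact quot_scale1 : left_id 1 quot_scale.
Proof. by move=> x; rewrite -[x]quot_projK projE scale1r. Qed.
Fact quot_scaleDr : right_distributive quot_scale +%R.
Proof.
move=> k x y; rewrite -[x]quot_projK -[y]quot_projK.
by rewrite !(quot_scaleE, =^~ raddfD quot_proj) scalerDr.
Qed.
Fact quot_scaleDl x : {morph quot_scale^~ x : a b / a + b}.
Proof. by move=> a b; rewrite -[x]quot_projK !projE scalerDl. Qed.

HB.instance Definition _ := GRing.Zmodule_isLmodule.Build K quot_algebra
  quot_scaleA quot_scale1 quot_scaleDr quot_scaleDl.

Lemma quot_projM : {morph quot_proj : u v / u * v}.
Proof. by move=> u v; rewrite -quot_mulE. Qed.

Lemma quot_proj1 : quot_proj 1 = 1.
Proof. by []. Qed.

Lemma quot_projZ k : {morph quot_proj : u / k *: u}.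
Proof. by move=> u; rewrite -quot_scaleE. Qed.

Lemma quot_scalerAl k (x y : quot_algebra) : k *: (x * y) = (k *: x) * y.
Proof.
rewrite -[x]quot_projK -[y]quot_projK.
by rewrite -quot_projM -!quot_projZ -quot_projM scalerAl.
Qed.

Lemma quot_scalerAr k (x y : quot_algebra) : k *: (x * y) = x * (k *: y).
Proof.
rewrite -[x]quot_projK -[y]quot_projK.
by rewrite -quot_projM -!quot_projZ -quot_projM scalerAr.
Qed.

End QuotientAlgebra.

(* Bases of a possibly infinite-dimensional module: the family v, restricted to
   the indices in D, is linearly independent (so injective on D when K is not
   trivial), and it spans. *)
Section Basis.
Variables (K : nzRingType) (V : lmodType K) (I : eqType).
Variables (D : {pred I}) (v : I -> V).

Definition lin_independent : Prop :=
  forall (s : seq I) (c : I -> K), uniq s -> {subset s <= D} ->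
    \sum_(i <- s) c i *: v i = 0 -> {in s, forall i, c i = 0}.

Definition lin_spanning : Prop :=
  forall u : V, exists (s : seq I) (c : I -> K),
    {subset s <= D} /\ u = \sum_(i <- s) c i *: v i.

Definition is_basis : Prop := lin_independent /\ lin_spanning.

End Basis.

(* The tensor indices 1 and 2 are the elements 0 and 1 of 'I_2, and the letters
   a, b, c are the elements 0, 1, 2 of 'I_3. *)
Notation idx1 := (0 : 'I_2).
Notation idx2 := (1 : 'I_2).

(* The triple (x, i, j) stands for the generator x^i_j. *)
Definition sphere_index : Type := ('I_3 * 'I_2 * 'I_2)%type.
HB.instance Definition _ := Finite.on sphere_index.

Section SphereAlgebra.
Variables (K : fieldType) (s q : K).

(* T^{ij}_{kl} is written T i j k l. The three tensors of the presentation have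
   the same support: the entries 11,11 and 22,22 have a common value u, the
   entries 12,12 and 21,21 a common value v, and the entry with upper indices
   21 and lower indices 12 is w. *)
Definition six_vertex (u v w : K) (i j k l : 'I_2) : K :=
  match val i, val j, val k, val l with
  | 0, 0, 0, 0 | 1, 1, 1, 1 => u
  | 0, 1, 0, 1 | 1, 0, 1, 0 => v
  | 1, 0, 0, 1 => w
  | _, _, _, _ => 0%R
  end%N.

(* s is the chosen square root q^{1/2}. *)
Definition Rmat := six_vertex (s * q) s (s * (q - q^-1)).
Definition Rinv := six_vertex (s^-1 * q^-1) s^-1 (- (s^-1 * (q - q^-1))).
Definition Rtilde :=
  six_vertex (s^-1 * q^-1) s^-1 (s^-1 * q ^- 2 * (q^-1 - q)).

Notation F := (free_algebra K sphere_index).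

Definition sphere_gen (x : 'I_3) (i j : 'I_2) : F := free_gen K (x, i, j).
Notation X := sphere_gen.

Definition cross_rhs (x y : 'I_3) (e f g h : 'I_2) : F :=
  \sum_(i < 2) \sum_(j < 2) \sum_(k < 2) \sum_(l < 2)
  \sum_(m < 2) \sum_(n < 2) \sum_(o < 2) \sum_(p < 2)
    (Rtilde i g f j * Rmat e j k l * Rmat m n i h * Rinv k o p n)
      *: (X x l o * X y p m).

Local Notation "x '_11'" := (X x idx1 idx1) (at level 1, format "x '_11'").
Local Notation "x '_12'" := (X x idx1 idx2) (at level 1, format "x '_12'").
Local Notation "x '_21'" := (X x idx2 idx1) (at level 1, format "x '_21'").
Local Notation "x '_22'" := (X x idx2 idx2) (at level 1, format "x '_22'").

(* sphere_relation u v: the presentation has the relation u = v. *)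
Inductive sphere_relation : F -> F -> Prop :=
| rel_12_11 x : sphere_relation (x _12 * x _11)
    (x _11 * x _12 + (1 - q ^- 2) *: (x _12 * x _22))
| rel_21_11 x : sphere_relation (x _21 * x _11)
    (x _11 * x _21 - (q ^- 2 * (1 - q ^- 2)) *: (x _21 * x _22))
| rel_21_12 x : sphere_relation (x _21 * x _12)
    (x _12 * x _21 + (1 - q ^- 2) *: (x _11 * x _22 - x _22 * x _22))
| rel_22_11 x : sphere_relation (x _22 * x _11) (x _11 * x _22)
| rel_22_12 x : sphere_relation (x _22 * x _12) (q ^+ 2 *: (x _12 * x _22))
| rel_22_21 x : sphere_relation (x _22 * x _21) (q ^- 2 *: (x _21 * x _22))
| rel_11_22 x : sphere_relation (x _11 * x _22)
    (1 + q ^+ 2 *: (x _12 * x _21))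
| rel_cross (x y : 'I_3) e f g h : (x < y)%N ->
    sphere_relation (X y e f * X x g h) (cross_rhs x y e f g h).

Definition sphere_algebra : Type := quot_algebra sphere_relation.
HB.instance Definition _ := GRing.PzRing.on sphere_algebra.
HB.instance Definition _ := GRing.Lmodule.on sphere_algebra.

Definition sphere_elt (x : 'I_3) (i j : 'I_2) : sphere_algebra :=
  quot_proj sphere_relation (X x i j).

(* An exponent family m assigns to (x, i, j) the exponent of x^i_j. *)
Definition pbw_exponent : {pred {ffun sphere_index -> nat}} :=
  fun m => [forall x : 'I_3, (m (x, idx1, idx2) == 0%N)
                          || (m (x, idx2, idx1) == 0%N)].

Definition pbw_monomial (m : {ffun sphere_index -> nat}) : sphere_algebra :=
  \prod_(x < 3)
    (sphere_elt x idx1 idx1 ^+ m (x, idx1, idx1) *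
     sphere_elt x idx1 idx2 ^+ m (x, idx1, idx2) *
     sphere_elt x idx2 idx1 ^+ m (x, idx2, idx1) *
     sphere_elt x idx2 idx2 ^+ m (x, idx2, idx2)).

End SphereAlgebra.

Definition generic (K : fieldType) (q : K) : Prop :=
  q != 0 /\ forall n : nat, (0 < n)%N -> q ^+ n != 1.

(* Main.v *)
From HB Require Import structures.
Require Import Defs.
From mathcomp Require Import all_boot all_order all_algebra.
From mathcomp Require Import finmap ring.
From mathcomp Require Import reals complex.
From mathcomp.multinomials Require Import monalg.

(* The relations orient into a quadratic rewriting system on words in the twelve
   generators: a later letter moves to the right of an earlier one, the generators
   of one letter are sorted in the order 11, 12, 21, 22, and x^1_2 x^2_1 is replaced
   by q^-2 (x^1_1 x^2_2 - 1).  The irreducible words are exactly the PBW monomials.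
   A word, read as a composition of affine functions, decreases under each rule, so
   they span.  The 256 overlaps are resolvable, which is a finite computation with
   Laurent polynomials in s = q^(1/2), so by Bergman's diamond lemma they are linearly
   independent. *)

Set Implicit Arguments.
Unset Strict Implicit.
Unset Printing Implicit Defensive.

Import GRing.Theory.
Local Open Scope ring_scope.

(** * Bergman's diamond lemma for quadratic rewriting systems *)

Section Redex.
Variables (T R : Type) (rule : T -> T -> option R).

Definition irreducible (a b : T) : bool := ~~ rule a b.

(** Always taking the leftmost reducible pair makes reduction deterministic, so that normal forms
    are given by a function. The result lists the prefix, the right-hand side of the rule and the
    suffix. *)
Fixpoint redex (w : seq T) : option (seq T * R * seq T) :=
  if w is a :: (b :: v) as w' then
    if rule a b is Some r then Some ([::], r, v)
    else omap (fun x => (a :: x.1.1, x.1.2, x.2)) (redex w')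
  else None.

Lemma sorted_irreducible w : sorted irreducible w = ~~ redex w.
Proof.
elim: w => [|a [|b v] IHw] //; rewrite [LHS]/= -/(sorted irreducible (b :: v)) IHw.
rewrite /irreducible; case E: (redex (b :: v)) => [x|]; move: E => /= ->.
  by case: (rule a b).
by case: (rule a b).
Qed.

Lemma redex_Some w u r v : redex w = Some (u, r, v) ->
  exists a b, w = u ++ [:: a, b & v] /\ rule a b = Some r.
Proof.
elim: w u => [|a [|b w] IHw] // u.
case E: (redex (b :: w)) IHw => [[[u' r'] v']|] IHw; move: E => /= ->;
  case E: (rule a b) => [s|] //= []; last by move=> <- <- <-; exists a, b.
  by move=> <- <- <-; exists a, b.
move=> Eu Er Ev; subst u r v; have [a' [b' [-> ?]]] := IHw _ erefl.
by exists a', b'.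
Qed.

(** Serves to compare an arbitrary reduction with the leftmost one, which acts at the same place or
    further to the left. *)
Lemma redex_leftmost u a b v r : rule a b = Some r ->
  exists x, redex (u ++ [:: a, b & v]) = Some x /\ (size x.1.1 <= size u)%N.
Proof.
move=> rab; elim: u => [|c u [x [Ex lex]]] /=.
  by rewrite rab; eexists; split; first reflexivity.
case Eu: (u ++ _) => [|d w]; first by case: (u) Eu.
case: (rule c d) => [r'|]; first by eexists; split; first reflexivity.
by rewrite -Eu Ex /=; eexists; split; first reflexivity.
Qed.

End Redex.

Section Diamond.
Variables (T C : eqType) (K : comPzRingType) (kappa : C -> K).
Variable rule : T -> T -> option (seq (C * seq T)).
Variable mu : seq T -> nat.

(** Quantifying over contexts makes the comparison stable under concatenation, as the diamond lemma
    requires of its order on words. *)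
Definition smaller (w w' : seq T) : Prop :=
  forall u v, (mu (u ++ w ++ v) < mu (u ++ w' ++ v))%N.

Hypothesis rule_smaller : forall a b r t,
  rule a b = Some r -> t \in r -> smaller t.2 [:: a; b].

Section LinearFunctional.
Variable V : lmodType K.

Definition eval (f : seq T -> V) (p : seq (C * seq T)) : V :=
  \sum_(t <- p) kappa t.1 *: f t.2.

(** The predicate [P] limits the words at which relations are imposed. If it always holds, [f]
    describes a functional on the quotient; the words below an overlap give the weaker condition
    that an induction can supply. *)
Definition respects (P : seq T -> Prop) (f : seq T -> V) : Prop :=
  forall u a b v r, rule a b = Some r -> P (u ++ [:: a, b & v]) ->
    f (u ++ [:: a, b & v]) = eval (fun w => f (u ++ w ++ v)) r.

Lemma eq_eval f g p : (forall t, t \in p -> f t.2 = g t.2) ->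
  eval f p = eval g p.
Proof. by move=> fg; apply: eq_big_seq => t /fg ->. Qed.

End LinearFunctional.

(* The overlap a b c is resolvable: every functional that satisfies the relations
   at the words below a b c takes the same value on the two reductions of a b c. *)
Hypothesis overlaps_resolvable : forall (V : lmodType K) a b c r1 r2,
  rule a b = Some r1 -> rule b c = Some r2 ->
  forall f : seq T -> V, respects (smaller^~ [:: a; b; c]) f ->
    eval (fun w => f (w ++ [:: c])) r1 = eval (fun w => f (a :: w)) r2.

Variables (V : lmodType K) (e : seq T -> V).

(** Reduction is not structurally recursive, so it runs on fuel [n]. The value 0 is a dummy, never
    reached when the fuel exceeds [mu w]. *)
Fixpoint normalize (n : nat) (w : seq T) : V :=
  if n is n'.+1 then
    if redex rule w is Some (u, r, v)
    then eval (fun m => normalize n' (u ++ m ++ v)) r else e w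
  else 0.

Lemma redex_smaller w u r v t : redex rule w = Some (u, r, v) -> t \in r ->
  (mu (u ++ t.2 ++ v) < mu w)%N.
Proof.
move=> E tr; have [a [b [-> rab]]] := redex_Some E.
by have := rule_smaller rab tr u v.
Qed.

Lemma normalize_fuel n n' w : (mu w < n)%N -> (mu w < n')%N ->
  normalize n w = normalize n' w.
Proof.
elim: n n' w => [|n IHn] [|n'] w //= ltn ltn'.
case E: (redex rule w) => [[[u r] v]|//]; apply: eq_eval => t tr.
have lt := redex_smaller E tr.
by apply: IHn; apply: leq_trans lt _.
Qed.

Definition normal_form (w : seq T) : V := normalize (mu w).+1 w.

Lemma normal_form_irreducible w : redex rule w = None -> normal_form w = e w.
Proof. by rewrite /normal_form /= => ->. Qed.

Lemma normal_formE w u r v : redex rule w = Some (u, r, v) ->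
  normal_form w = eval (fun m => normal_form (u ++ m ++ v)) r.
Proof.
move=> E; rewrite /normal_form [LHS]/= E; apply: eq_eval => t tr.
by apply: normalize_fuel => //; apply: redex_smaller E tr.
Qed.

Lemma normal_form_ind (P : seq T -> V -> Prop) :
  (forall w, redex rule w = None -> P w (e w)) ->
  (forall w u r v, redex rule w = Some (u, r, v) ->
    (forall t, t \in r -> P (u ++ t.2 ++ v) (normal_form (u ++ t.2 ++ v))) ->
    P w (eval (fun m => normal_form (u ++ m ++ v)) r)) ->
  forall w, P w (normal_form w).
Proof.
move=> Pirr Pred w; have [n] := ubnP (mu w); elim: n => // n IHn in w * => ltn.
case E: (redex rule w) => [[[u r] v]|]; last first.
  by rewrite normal_form_irreducible //; apply: Pirr.
rewrite (normal_formE E); apply: Pred => // t tr; apply: IHn.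
by apply: leq_trans (redex_smaller E tr) _.
Qed.

(** Both sides obey the same recursion along leftmost reduction, so agreement on irreducible words
    propagates to all words. *)
Lemma normal_form_morph (W : lmodType K) (L : {linear V -> W}) (f : seq T -> W) :
  respects (fun=> True) f ->
  (forall w, redex rule w = None -> L (e w) = f w) ->
  forall w, L (normal_form w) = f w.
Proof.
move=> f_resp Le; apply: (normal_form_ind (P := fun w x => L x = f w)) => //.
move=> w u r v E IH; have [a [b [-> rab]]] := redex_Some E.
rewrite (f_resp _ _ _ _ _ rab I) linear_sum; apply: eq_big_seq => t tr /=.
by rewrite linearZ /= IH.
Qed.

(** The core of the diamond lemma. By induction on [mu], the given reduction is compared with the
    leftmost one; the two reduced pairs coincide, share one letter, or are disjoint. *)
Lemma normal_form_respects : respects (fun=> True) normal_form.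
Proof.
move=> u a b v r rab _ /=.
have [n] := ubnP (mu (u ++ [:: a, b & v])).
elim: n => // n IHn in u a b v r rab * => ltn.
have [[[u0 r0] v0] [E /= le_size]] := redex_leftmost u v rab.
have [a0 [b0 [Ew r0ab]]] := redex_Some E.
(* The induction hypothesis, for a smaller word given up to an equation with any reducible pair in
   it. *)
have below w (lt_w : (mu w < mu (u ++ [:: a, b & v]))%N) u1 a1 b1 v1 r1 :
    rule a1 b1 = Some r1 -> w = u1 ++ [:: a1, b1 & v1] ->
    normal_form w = eval (fun m => normal_form (u1 ++ m ++ v1)) r1.
  by move=> r1ab Ew1; rewrite Ew1 in lt_w *; apply: IHn (leq_trans lt_w _).
rewrite (normal_formE E).
(* The word [z] is the rest of [u] from the leftmost redex on; its length 0, 1 or at least 2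
   separates the three cases. *)
have [z Eu] : exists z, u = u0 ++ z.
  exists (drop (size u0) u); rewrite -{1}(cat_take_drop (size u0) u).
  congr (_ ++ _); have := congr1 (take (size u0)) Ew.
  by rewrite takel_cat // => ->; rewrite take_size_cat.
have lt0 t : t \in r0 -> (mu (u0 ++ t.2 ++ v0) < mu (u ++ [:: a, b & v]))%N.
  exact: redex_smaller E.
have lt1 t : t \in r -> (mu (u ++ t.2 ++ v) < mu (u ++ [:: a, b & v]))%N.
  by move=> tr; have := rule_smaller rab tr u v.
move/eqP: Ew; rewrite {1}Eu -catA eqseq_cat // eqxx /= => /eqP Ew.
case: z => [|c [|c' x]] in Eu Ew.
- case: Ew => ? ? ?; subst a0 b0 v0; move: r0ab; rewrite rab Eu cats0.
  by case=> <-.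
- case: Ew => ? ? ?; subst c b0 v0 u.
  (* Placing words between [u0] and [v] gives a functional that respects the relations below the
     overlap [a0 a b], by the induction hypothesis. *)
  have ovl := overlaps_resolvable r0ab rab
    (f := fun w => normal_form (u0 ++ w ++ v)).
  have -> : eval (fun m => normal_form (u0 ++ m ++ b :: v)) r0 =
      eval (fun m => normal_form (u0 ++ (m ++ [:: b]) ++ v)) r0.
    by apply: eq_eval => t _; rewrite -catA.
  rewrite ovl; first by apply: eq_eval => t _; rewrite -catA.
  move=> u1 a1 b1 v1 r1 r1ab lt_w.
  have {}lt_w := lt_w u0 v; rewrite (below _ _ (u0 ++ u1) _ _ (v1 ++ v) _ r1ab).
  + by apply: eq_eval => t _; rewrite -!catA.
  + by move: lt_w; rewrite -!catA.
  + by rewrite -!catA.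
- case: Ew => ? ? ?; subst c c' v0 u.
  (* For disjoint pairs, both are reduced in either order, and the double sums agree because the
     coefficients commute. *)
  transitivity (eval (fun m => eval (fun m' =>
      normal_form (u0 ++ m ++ x ++ m' ++ v)) r) r0).
    apply: eq_eval => t tr0; rewrite (below _ (lt0 _ tr0) (u0 ++ t.2 ++ x) a b v _ rab).
      by apply: eq_eval => t' _; rewrite -!catA.
    by rewrite -!catA.
  transitivity (eval (fun m' => eval (fun m =>
      normal_form (u0 ++ m ++ x ++ m' ++ v)) r0) r).
    rewrite /eval; under eq_bigr do rewrite scaler_sumr.
    under [RHS]eq_bigr do rewrite scaler_sumr.
    rewrite exchange_big; apply: eq_bigr => t _; apply: eq_bigr => t' _.
    by rewrite !scalerA mulrC.
  apply: eq_eval => t tr.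
  rewrite [RHS](below _ (lt1 _ tr) u0 a0 b0 (x ++ t.2 ++ v) _ r0ab) //.
  by rewrite -!catA.
Qed.

End Diamond.

(** * Mechanical reduction over Laurent polynomials in [s] *)

(* The pair [(c, e)] stands for [c * s ^ e]. *)
Definition term : Type := (int * int)%type.
HB.instance Definition _ := Equality.on term.

Definition term_mul (c d : term) : term := (c.1 * d.1, c.2 + d.2).

Section Collect.
Variable X : eqType.

(** Like terms are merged and zero coefficients dropped, so that cancellation can be tested by
    emptiness of the list. *)
Fixpoint insert (t : term * X) (p : seq (term * X)) : seq (term * X) :=
  if p is x :: p' then
    if (t.1.2 == x.1.2) && (t.2 == x.2) then
      let c := t.1.1 + x.1.1 in
      if c == 0 then p' else ((c, x.1.2), x.2) :: p'
    else x :: insert t p'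
  else [:: t].

Definition collect (p : seq (term * X)) : seq (term * X) := foldr insert [::] p.

Lemma insert_keys (P : X -> Prop) t p : P t.2 ->
  (forall x, x \in p -> P x.2) -> forall x, x \in insert t p -> P x.2.
Proof.
move=> Pt; elim: p => [|y p IHp] /= Pp x; first by rewrite inE => /eqP->.
have {}IHp := IHp (fun x xp => Pp x (mem_behead (s := y :: p) xp)).
have Py := Pp y (mem_head _ _).
have Pp' z (zp : z \in p) : P z.2 by apply: Pp; rewrite inE zp orbT.
case: ifP => _; first case: ifP => _; rewrite ?inE; first exact: Pp'.
  by case/predU1P=> [->|/Pp'].
by case/predU1P=> [->|/IHp].
Qed.

Lemma collect_keys (P : X -> Prop) p :
  (forall x, x \in p -> P x.2) -> forall x, x \in collect p -> P x.2.
Proof.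
elim: p => [|t p IHp] //= Pp; apply: insert_keys; first exact/Pp/mem_head.
by apply: IHp => x xp; apply: Pp; rewrite inE xp orbT.
Qed.

End Collect.

Section Reduce.
Variables (T : eqType) (rule : T -> T -> option (seq (term * seq T))).

Definition reduce (p : seq (term * seq T)) : seq (term * seq T) :=
  collect (flatten [seq
    if redex rule t.2 is Some (u, r, v)
    then [seq (term_mul t.1 x.1, u ++ x.2 ++ v) | x <- r] else [:: t] | t <- p]).

Variables (K : fieldType) (s : K).
Hypothesis s_neq0 : s != 0.

Definition term_val (c : term) : K := c.1%:~R * s ^ c.2.

Lemma term_valM c d : term_val (term_mul c d) = term_val c * term_val d.
Proof. by rewrite /term_val /= intrM expfzDr // mulrACA. Qed.

Section Eval.
Variables (V : lmodType K) (X : eqType) (f : seq X -> V).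

Lemma eval_nil : eval term_val f [::] = 0.
Proof. by rewrite /eval big_nil. Qed.

Lemma eval_cons t p :
  eval term_val f (t :: p) = term_val t.1 *: f t.2 + eval term_val f p.
Proof. by rewrite /eval big_cons. Qed.

Lemma eval_cat p1 p2 :
  eval term_val f (p1 ++ p2) = eval term_val f p1 + eval term_val f p2.
Proof. by rewrite /eval big_cat. Qed.

Lemma eval_flatten I (l : seq I) g :
  eval term_val f (flatten [seq g i | i <- l]) =
  \sum_(i <- l) eval term_val f (g i).
Proof. by rewrite /eval big_flatten big_map. Qed.

Lemma eval_map (Y : eqType) (h : seq Y -> seq X) p :
  eval term_val f [seq (t.1, h t.2) | t <- p] = eval term_val (f \o h) p.
Proof. by rewrite /eval big_map. Qed.

Lemma eval_scale (Y : eqType) (h : seq Y -> seq X) c p :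
  eval term_val f [seq (term_mul c t.1, h t.2) | t <- p] =
  term_val c *: eval term_val (f \o h) p.
Proof.
rewrite /eval big_map scaler_sumr; apply: eq_bigr => t _.
by rewrite scalerA -term_valM.
Qed.

Lemma eval_collect p : eval term_val f (collect p) = eval term_val f p.
Proof.
elim: p => //= t p IHp; rewrite eval_cons -{}IHp.
elim: (collect p) => [|x q IHq] /=; first by rewrite eval_cons.
case: ifP => [/andP[/eqP e1 /eqP e2]|_]; last first.
  by rewrite !eval_cons IHq addrCA.
have E : term_val t.1 *: f t.2 + (term_val x.1 *: f x.2 + eval term_val f q) =
    term_val (t.1.1 + x.1.1, x.1.2) *: f x.2 + eval term_val f q.
  by rewrite addrA /term_val e1 e2 -scalerDl -mulrDl -intrD.
rewrite eval_cons E; case: ifP => [/eqP->|_]; rewrite ?eval_cons //.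
by rewrite /term_val mul0r scale0r add0r.
Qed.

End Eval.

Section Soundness.
Variables (V : lmodType K) (P : seq T -> Prop) (f : seq T -> V).
Hypothesis f_respects : respects term_val rule P f.
Hypothesis P_closed : forall u a b v r t, rule a b = Some r -> t \in r ->
  P (u ++ [:: a, b & v]) -> P (u ++ t.2 ++ v).

Lemma eval_reduce p : (forall t, t \in p -> P t.2) ->
  eval term_val f (reduce p) = eval term_val f p.
Proof.
move=> Pp; rewrite eval_collect eval_flatten; apply: eq_big_seq => t tp.
case E: (redex rule t.2) => [[[u r] v]|]; last by rewrite eval_cons eval_nil addr0.
have [a [b [Ew rab]]] := redex_Some E.
rewrite (eval_scale _ (fun w => u ++ w ++ v)); congr (_ *: _).
by have := Pp t tp; rewrite Ew => Pw; rewrite (f_respects rab Pw).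
Qed.

Lemma reduce_closed p : (forall t, t \in p -> P t.2) ->
  forall t, t \in reduce p -> P t.2.
Proof.
move=> Pp; apply: collect_keys => t /flatten_mapP[x xp].
case E: (redex rule x.2) => [[[u r] v]|]; last by rewrite inE => /eqP->; apply: Pp.
case/mapP=> y yr -> /=; have [a [b [Ew rab]]] := redex_Some E.
by apply: P_closed rab yr _; rewrite -Ew; apply: Pp.
Qed.

(** A computable certificate of vanishing: reduction preserves the value of [f] and never leaves
    [P], so a sum that cancels completely had value 0 from the start. *)
Lemma eval_eq0 n p : nilp (iter n reduce p) -> (forall t, t \in p -> P t.2) ->
  eval term_val f p = 0.
Proof.
elim: n p => [|n IHn] p; first by move/nilP=> /= -> _; rewrite eval_nil.
rewrite iterSr => /IHn{}IHn Pp; rewrite -eval_reduce //; apply: IHn.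
exact: reduce_closed.
Qed.

End Soundness.
End Reduce.

(** * The rewriting system of the sphere algebra *)

(* [None], [Some false] and [Some true] are the letters a, b and c; the tensor
   indices 1 and 2 are [false] and [true]. *)
Definition code : Type := (option bool * bool * bool)%type.
HB.instance Definition _ := Equality.on code.

Definition letter_rank (x : option bool) : nat := if x is Some b then b.+1 else 0.

Definition laurent_mul (p p' : seq term) : seq term :=
  [seq term_mul c d | c <- p, d <- p'].

Definition six_vertex_laurent (u v w : seq term) (i j k l : bool) : seq term :=
  match i, j, k, l with
  | false, false, false, false | true, true, true, true => u
  | false, true, false, true | true, false, true, false => v
  | true, false, false, true => w
  | _, _, _, _ => [::]
  end.

(** The entries are expanded in powers of [s] with [q = s ^+ 2]; thus [s * (q - q^-1)] becomes
    [s^3 - s^-1]. *)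
Definition R_laurent : bool -> bool -> bool -> bool -> seq term :=
  six_vertex_laurent [:: (1, 3)] [:: (1, 1)] [:: (1, 3); (-1, -1)].
Definition Rinv_laurent : bool -> bool -> bool -> bool -> seq term :=
  six_vertex_laurent [:: (1, -3)] [:: (1, -1)] [:: (-1, 1); (1, -3)].
Definition Rtilde_laurent : bool -> bool -> bool -> bool -> seq term :=
  six_vertex_laurent [:: (1, -3)] [:: (1, -1)] [:: (1, -7); (-1, -3)].

(* A letter [(z, i, j) : bool * bool * bool] stands for [x^i_j] or [y^i_j],
   according to [z], in a rule that reorders [y] and [x]. *)
Definition cross_terms (e f g h : bool) : seq (term * seq (bool * bool * bool)) :=
  let B := [:: false; true] in
  flatten [seq flatten [seq flatten [seq flatten [seq
  flatten [seq flatten [seq flatten [seq flatten [seq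
    [seq (c, [:: (false, l, o); (true, p, m)]) |
      c <- laurent_mul (laurent_mul (laurent_mul
        (Rtilde_laurent i g f j) (R_laurent e j k l)) (R_laurent m n i h))
        (Rinv_laurent k o p n)]
  | p <- B] | o <- B] | n <- B] | m <- B] | l <- B] | k <- B] | j <- B] | i <- B].

(** The eightfold sums are evaluated once and stored, so that the overlap computation only looks
    them up. The bits [e f g h], read in binary, give the position. *)
Definition cross_table : seq (seq (term * seq (bool * bool * bool))) :=
  Eval vm_compute in
  let B2 := [seq (i, j) | i <- [:: false; true], j <- [:: false; true]] in
  [seq collect (cross_terms ef.1 ef.2 gh.1 gh.2) | ef <- B2, gh <- B2].

Definition cross_rule (e f g h : bool) : seq (term * seq (bool * bool * bool)) :=
  nth [::] cross_table (8 * e + 4 * f + 2 * g + h).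

Lemma cross_ruleE e f g h : cross_rule e f g h = collect (cross_terms e f g h).
Proof. by case: e; case: f; case: g; case: h; vm_compute. Qed.

(* The rule for [x^2_1 x^1_2] is its relation in (1) with [x^1_2 x^2_1] eliminated
   by [x^1_1 x^2_2 = 1 + q^2 x^1_2 x^2_1]. *)
Definition same_letter_rule (i j k l : bool) :
    option (seq (term * seq (bool * bool * bool))) :=
  let A := (false, false, false) in
  let B := (false, false, true) in
  let C := (false, true, false) in
  let D := (false, true, true) in
  match i, j, k, l with
  | false, true, false, false =>
      Some [:: ((1, 0), [:: A; B]); ((1, 0), [:: B; D]); ((-1, -4), [:: B; D])]
  | true, false, false, false =>
      Some [:: ((1, 0), [:: A; C]); ((-1, -4), [:: C; D]); ((1, -8), [:: C; D])]
  | true, false, false, true =>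
      Some [:: ((1, 0), [:: A; D]); ((-1, -4), [::]);
               ((-1, 0), [:: D; D]); ((1, -4), [:: D; D])]
  | false, true, true, false =>
      Some [:: ((1, -4), [:: A; D]); ((-1, -4), [::])]
  | true, true, false, false => Some [:: ((1, 0), [:: A; D])]
  | true, true, false, true => Some [:: ((1, 4), [:: B; D])]
  | true, true, true, false => Some [:: ((1, -4), [:: C; D])]
  | _, _, _, _ => None
  end.

Definition relabel (x y : option bool) (t : bool * bool * bool) : code :=
  (if t.1.1 then y else x, t.1.2, t.2).

Definition relabel_rule x y (p : seq (term * seq (bool * bool * bool))) :=
  [seq (t.1, map (relabel x y) t.2) | t <- p].

Definition sphere_rule (a b : code) : option (seq (term * seq code)) :=
  let: (y, e, f) := a in
  let: (x, g, h) := b in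
  if letter_rank x == letter_rank y
  then omap (relabel_rule x x) (same_letter_rule e f g h)
  else if (letter_rank x < letter_rank y)%N
  then Some (relabel_rule x y (cross_rule e f g h)) else None.

Definition codes : seq code :=
  [seq (x, i.1, i.2) | x <- [:: None; Some false; Some true],
    i <- [:: (false, false); (false, true); (true, false); (true, true)]].

Lemma mem_codes a : a \in codes.
Proof. by move: a => [[[[]|] []] []]. Qed.

(* A word is interpreted as a composition of affine functions; the slopes grow
   with the letters fast enough for the reorderings to decrease the value. *)
Definition slope (a : code) : nat := 2 * 4 ^ letter_rank a.1.1.

Definition intercept (a : code) : nat :=
  match a.1.2, a.2 with false, false => 3 | true, true => 1 | _, _ => 2 end.

Definition word_measure (w : seq code) : nat :=
  foldr (fun a n => slope a * n + intercept a)%N 0%N w.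

Definition word_slope (w : seq code) : nat := foldr (fun a n => slope a * n)%N 1%N w.

Lemma word_measure_cat w v :
  word_measure (w ++ v) = (word_slope w * word_measure v + word_measure w)%N.
Proof.
by elim: w => [|a w IHw] /=; rewrite ?mul1n ?addn0 // IHw mulnDr mulnA addnA.
Qed.

Lemma word_slope_gt0 w : (0 < word_slope w)%N.
Proof. by elim: w => //= a w IHw; rewrite !muln_gt0 expn_gt0. Qed.

(** A suffix [v] inserts a nonnegative argument into the affine functions of [w] and [w'], and a
    prefix applies an affine function of positive slope; both keep the strict inequality. *)
Lemma smallerP w w' :
  (word_slope w <= word_slope w')%N && (word_measure w < word_measure w')%N ->
  smaller word_measure w w'.
Proof.
case/andP=> le_slope lt_measure u v; rewrite !word_measure_cat ltn_add2r.
by rewrite ltn_pmul2l ?word_slope_gt0 // -addnS leq_add // leq_mul2r le_slope orbT.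
Qed.

Definition rules_decreasing : bool :=
  all (fun a => all (fun b => if sphere_rule a b is Some r then
    all (fun t : term * seq code => (word_slope t.2 <= word_slope [:: a; b])%N &&
      (word_measure t.2 < word_measure [:: a; b])%N) r else true) codes) codes.

Lemma sphere_rule_smaller a b r t : sphere_rule a b = Some r -> t \in r ->
  smaller word_measure t.2 [:: a; b].
Proof.
have /allP/(_ a (mem_codes a))/allP/(_ b (mem_codes b)) : rules_decreasing.
  by vm_compute.
by move=> Hab rab; rewrite rab in Hab; move/(allP Hab)/smallerP.
Qed.

(** The difference of the two reductions of [a b c]. Triples without an overlap give the empty sum
    and pass the test trivially. *)
Definition overlap (a b c : code) : seq (term * seq code) :=
  if sphere_rule a b is Some r1 then
    if sphere_rule b c is Some r2 then
      [seq (t.1, t.2 ++ [:: c]) | t <- r1] ++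
      [seq (term_mul (-1, 0) t.1, a :: t.2) | t <- r2]
    else [::]
  else [::].

(** Since [reduce] fixes the empty sum, 12 is a uniform bound on the number of rounds. The
    coefficients are formal Laurent polynomials over the integers, so one computation serves every
    field and every nonzero [s]. *)
Definition overlaps_vanish : bool :=
  all (fun a => all (fun b => all (fun c =>
    nilp (iter 12 (reduce sphere_rule) (overlap a b c))) codes) codes) codes.

Lemma sphere_overlaps_resolvable (K : fieldType) (s : K) : s != 0 ->
  forall (V : lmodType K) a b c r1 r2,
  sphere_rule a b = Some r1 -> sphere_rule b c = Some r2 ->
  forall f : seq code -> V,
  respects (term_val s) sphere_rule (smaller word_measure ^~ [:: a; b; c]) f ->
    eval (term_val s) (fun w => f (w ++ [:: c])) r1 =
    eval (term_val s) (fun w => f (a :: w)) r2.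
Proof.
move=> s_neq0 V a b c r1 r2 rab rbc f f_resp.
have chk : overlaps_vanish by vm_compute.
move/allP/(_ a (mem_codes a))/allP/(_ b (mem_codes b)): chk.
move/allP/(_ c (mem_codes c)); rewrite /overlap rab rbc => chk.
(* Reducing a word below the overlap stays below it, so every step of the computation is one that
   [f] respects. *)
have closed u a' b' v r t : sphere_rule a' b' = Some r -> t \in r ->
    smaller word_measure (u ++ [:: a', b' & v]) [:: a; b; c] ->
    smaller word_measure (u ++ t.2 ++ v) [:: a; b; c].
  move=> rab' tr lt u' v'; apply: ltn_trans (lt u' v').
  have := sphere_rule_smaller rab' tr (u' ++ u) (v ++ v').
  by rewrite -!catA.
have := eval_eq0 s_neq0 f_resp closed chk.
rewrite eval_cat (eval_map _ _ (fun w => w ++ [:: c])).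
rewrite (eval_scale s_neq0 _ (cons a)) /term_val /= mulr1 scaleN1r => sum0.
apply/eqP; rewrite -subr_eq0; apply/eqP; apply: sum0 => t.
rewrite mem_cat => /orP[] /mapP[x xr ->] /= u v.
  have := sphere_rule_smaller rab xr u (c :: v).
  by rewrite -!catA.
have := sphere_rule_smaller rbc xr (u ++ [:: a]) v.
by rewrite -!catA.
Qed.

(** * Words in the free algebra *)

Definition index_of (b : bool) : 'I_2 := if b then idx2 else idx1.

Lemma letter_rank_lt3 x : (letter_rank x < 3)%N.
Proof. by case: x => [[]|]. Qed.

Definition letter_of (x : option bool) : 'I_3 := Ordinal (letter_rank_lt3 x).

Definition decode (a : code) : sphere_index :=
  (letter_of a.1.1, index_of a.1.2, index_of a.2).

Definition encode (x : sphere_index) : code :=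
  (nth None [:: None; Some false; Some true] x.1.1, x.1.2 != idx1, x.2 != idx1).

Lemma decodeK : cancel decode encode.
Proof. by move=> [[[[]|] []] []]. Qed.

Lemma encodeK : cancel encode decode.
Proof.
by move=> [[[[|[|[|//]]] ?] [[|[|//]] ?]] [[|[|//]] ?]];
  congr (_, _, _); apply: val_inj.
Qed.

Lemma sum_index (V : nmodType) (F : 'I_2 -> V) :
  \sum_(i < 2) F i = \sum_(b <- [:: false; true]) F (index_of b).
Proof.
rewrite !big_ord_recl big_ord0 !big_cons big_nil.
by congr (F _ + (F _ + _)); apply: val_inj.
Qed.

Section SphereAlgebra.
Variables (K : fieldType) (s : K).
Hypothesis s_neq0 : s != 0.

Let q := s ^+ 2.

Notation F := (free_algebra K sphere_index).
Notation A := (sphere_algebra s q).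
Notation val := (term_val s).

Definition word_elt (w : seq code) : F := << FMonom (map decode w) >>.

Lemma word_elt_cat u v : word_elt (u ++ v) = word_elt u * word_elt v.
Proof.
rewrite /word_elt map_cat.
have -> : FMonom (map decode u ++ map decode v) =
    mmul (FMonom (map decode u)) (FMonom (map decode v)).
  by apply: val_inj; rewrite /= fmM.
by rewrite -[RHS]/(_ * _ : {malg K[{fmonom sphere_index}]}) malgM_def fgmulUU mulr1.
Qed.

Lemma word_elt_nil : word_elt [::] = 1.
Proof. by rewrite /word_elt -fmoneE. Qed.

Lemma word_elt1 a : word_elt [:: a] = free_gen K (decode a).
Proof. by rewrite /word_elt /free_gen fmuE. Qed.

Lemma word_elt2 x i j y k l :
  word_elt [:: (x, i, j); (y, k, l)] =
  sphere_gen K (letter_of x) (index_of i) (index_of j) *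
  sphere_gen K (letter_of y) (index_of k) (index_of l).
Proof. by rewrite -cat1s word_elt_cat !word_elt1. Qed.

(** * Values of the Laurent coefficients and of the tensors *)

Definition laurent_val (p : seq term) : K := \sum_(c <- p) val c.

Lemma laurent_val_mul p p' :
  laurent_val (laurent_mul p p') = laurent_val p * laurent_val p'.
Proof.
rewrite /laurent_val big_allpairs_dep mulr_suml; apply: eq_bigr => c _.
by rewrite mulr_sumr; apply: eq_bigr => d _; rewrite term_valM.
Qed.

Lemma six_vertex_laurentE u v w i j k l :
  laurent_val (six_vertex_laurent u v w i j k l) =
  six_vertex (laurent_val u) (laurent_val v) (laurent_val w)
    (index_of i) (index_of j) (index_of k) (index_of l).
Proof. by case: i; case: j; case: k; case: l => //=; rewrite /laurent_val big_nil. Qed.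

Lemma term_val_pos n : val (1, n%:Z) = s ^+ n.
Proof. by rewrite /term_val mul1r. Qed.

Lemma term_val_inv n : val (1, - n%:Z) = s ^- n.
Proof. by rewrite /term_val mul1r exprnN. Qed.

Lemma term_valN e : val (-1, e) = - val (1, e).
Proof. by rewrite /term_val mul1r mulN1r. Qed.

(** Instances for the exponents that occur in the tensors and in the single-letter rules. *)
Definition term_valE :=
  (term_valN, term_val_pos 0, term_val_pos 1, term_val_pos 3, term_val_pos 4,
   term_val_inv 1, term_val_inv 3, term_val_inv 4, term_val_inv 7, term_val_inv 8).

Lemma R_laurentE i j k l : laurent_val (R_laurent i j k l) =
  Rmat s q (index_of i) (index_of j) (index_of k) (index_of l).
Proof.
rewrite six_vertex_laurentE; congr six_vertex;
  rewrite /laurent_val !big_cons big_nil !term_valE /q; by field.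
Qed.

Lemma Rinv_laurentE i j k l : laurent_val (Rinv_laurent i j k l) =
  Rinv s q (index_of i) (index_of j) (index_of k) (index_of l).
Proof.
rewrite six_vertex_laurentE; congr six_vertex;
  rewrite /laurent_val !big_cons big_nil !term_valE /q; by field.
Qed.

Lemma Rtilde_laurentE i j k l : laurent_val (Rtilde_laurent i j k l) =
  Rtilde s q (index_of i) (index_of j) (index_of k) (index_of l).
Proof.
rewrite six_vertex_laurentE; congr six_vertex;
  rewrite /laurent_val !big_cons big_nil !term_valE /q; by field.
Qed.

Lemma cross_rhsE x y e f g h :
  cross_rhs s q (letter_of x) (letter_of y)
    (index_of e) (index_of f) (index_of g) (index_of h) =
  eval val word_elt (relabel_rule x y (cross_rule e f g h)).
Proof.
rewrite /cross_rhs eval_map cross_ruleE eval_collect.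
(* Both sides nest the eight summations in the same order, so they are matched one index at a
   time. *)
do 8!(rewrite sum_index eval_flatten; apply: eq_bigr => ? _).
rewrite /eval big_map /= word_elt2 -scaler_suml.
by rewrite -Rtilde_laurentE -!R_laurentE -Rinv_laurentE -!laurent_val_mul.
Qed.

(** * Linear functionals: defining relations versus rewriting rules *)

Section Functional.
Variables (V : lmodType K) (L : {linear F -> V}).

(* Abstracting [L \o word_elt] keeps conversion away from the free algebra. *)
Variable LW : seq code -> V.
Hypothesis L_word : forall w, L (word_elt w) = LW w.

Definition satisfies_rules : Prop := forall a b r,
  sphere_rule a b = Some r -> LW [:: a; b] = eval val LW r.

Definition satisfies_relations : Prop := forall u v,
  sphere_relation s q u v -> L u = L v.

Let L_add a b va vb : L a = va -> L b = vb -> L (a + b) = va + vb.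
Proof. by move=> <- <-; exact: (raddfD L). Qed.

Let L_sub a b va vb : L a = va -> L b = vb -> L (a - b) = va - vb.
Proof. by move=> <- <-; exact: (raddfB L). Qed.

Let L_scale c a va : L a = va -> L (c *: a) = c *: va.
Proof. by move=> <-; exact: (linearZ_LR L). Qed.

Let L_gen x i j k l : L (sphere_gen K (letter_of x) (index_of i) (index_of j) *
    sphere_gen K (letter_of x) (index_of k) (index_of l)) =
  LW [:: (x, i, j); (x, k, l)].
Proof. by rewrite -L_word word_elt2. Qed.

Let L_one : L 1 = LW [::].
Proof. by rewrite -L_word word_elt_nil. Qed.

Let t := q ^- 2.

Let powE : (s ^+ 0 = 1) * (s ^+ 4 = q ^+ 2) * (s ^- 4 = t) * (s ^- 8 = t * t).
Proof. by rewrite /t /q -exprM -invfM -exprD. Qed.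

(** The values are arranged like the right-hand sides of the relations: five rules then match a
    relation verbatim, and only those for [x^2_1 x^1_2] and [x^1_2 x^2_1] need an argument. *)
Let same_letter_eval x i j k l r : same_letter_rule i j k l = Some r ->
  let w i j k l := LW [:: (x, i, j); (x, k, l)] in
  eval val LW (relabel_rule x x r) =
  match i, j, k, l with
  | false, true, false, false =>
      w false false false true + (1 - t) *: w false true true true
  | true, false, false, false =>
      w false false true false - (t * (1 - t)) *: w true false true true
  | true, false, false, true => t *: w false false true true - t *: LW [::] +
      (1 - t) *: (w false false true true - w true true true true)
  | false, true, true, false => t *: w false false true true - t *: LW [::]
  | true, true, false, false => w false false true true
  | true, true, false, true => q ^+ 2 *: w false true true true
  | true, true, true, false => t *: w true false true true
  | _, _, _, _ => 0
  end.
Proof.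
move=> + w; rewrite /relabel_rule eval_map.
case: i; case: j; case: k; case: l => //= -[<-];
  rewrite !eval_cons eval_nil /= !term_valE !powE /relabel /=
    ?scale1r ?addr0 ?scaleN1r ?scaleNr //.
- rewrite scalerBr !scalerBl !scale1r opprB addrACA [_ + (_ - t *: _)]addrC subrK.
  by rewrite [- LW _ + _]addrC.
- by rewrite mulrBr mulr1 scalerBl opprB; congr (_ + _); rewrite addrC.
- by rewrite scalerBl scale1r.
Qed.

Let same_letter x i j k l (r : seq (term * seq (bool * bool * bool))) :
  same_letter_rule i j k l = Some r ->
  sphere_rule (x, i, j) (x, k, l) = Some (relabel_rule x x r).
Proof. by move=> /= ->; rewrite eqxx. Qed.

Let q_neq0 : q != 0.
Proof. exact: expf_neq0. Qed.

Lemma relations_rules : satisfies_relations -> satisfies_rules.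
Proof.
move=> Lr.
have LR u v lu lv : sphere_relation s q u v -> L u = lu -> L v = lv -> lu = lv.
  by move=> r <- <-; apply: Lr.
move=> [[y e] f] [[x g] h] r /=.
case: eqP => [Exy|_]; last first.
  case: ifP => // ltxy [<-].
  rewrite -L_word word_elt2; apply: etrans (Lr _ _ (rel_cross _ _ _ _ _ _ _)) _ => //.
  by rewrite cross_rhsE // /eval linear_sum; apply: eq_bigr => i _; apply/L_scale/L_word.
have {Exy}-> : y = x by case: x y Exy => [[]|] [[]|].
case E: same_letter_rule => [p|] //= -[<-]; rewrite (same_letter_eval x E).
have A := L_gen x false false; have B := L_gen x false true.
have C := L_gen x true false; have D := L_gen x true true.
have BA := LR _ _ _ _ (rel_12_11 s q (letter_of x)) (B false false)
  (L_add (A false true) (L_scale _ (B true true))).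
have CA := LR _ _ _ _ (rel_21_11 s q (letter_of x)) (C false false)
  (L_sub (A true false) (L_scale _ (C true true))).
have CB := LR _ _ _ _ (rel_21_12 s q (letter_of x)) (C false true)
  (L_add (B true false) (L_scale _ (L_sub (A true true) (D true true)))).
have DA := LR _ _ _ _ (rel_22_11 s q (letter_of x)) (D false false) (A true true).
have DB := LR _ _ _ _ (rel_22_12 s q (letter_of x)) (D false true)
  (L_scale _ (B true true)).
have DC := LR _ _ _ _ (rel_22_21 s q (letter_of x)) (D true false)
  (L_scale _ (C true true)).
have AD := LR _ _ _ _ (rel_11_22 s q (letter_of x)) (A true true)
  (L_add L_one (L_scale _ (B true false))).
(* The relation for [x^1_1 x^2_2] is solved for [x^1_2 x^2_1], which uses that [q] is invertible. *)
have BC : LW [:: (x, false, true); (x, true, false)] =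
    t *: LW [:: (x, false, false); (x, true, true)] - t *: LW [::].
  by rewrite AD -scalerBr addrAC subrr add0r scalerA mulVf ?scale1r ?expf_neq0.
by case: e f g h E => [] [] [] [] //= _; rewrite // CB BC.
Qed.

(** The relation for [x^1_1 x^2_2] comes from solving the rule for [x^1_2 x^2_1], and the one for
    [x^2_1 x^1_2] from combining that rule with its own. The other relations are rules already. *)
Lemma rules_relations : satisfies_rules -> satisfies_relations.
Proof.
move=> Lr.
have letter x : exists x', x = letter_of x'.
  by exists (encode (x, idx1, idx1)).1.1; have := encodeK (x, idx1, idx1) => -[].
have index i : exists i', i = index_of i'.
  exists (encode (letter_of None, i, i)).2.
  by have := encodeK (letter_of None, i, i) => -[].
have LR x i j k l r := fun E => etrans (Lr _ _ _ (@same_letter x i j k l r E))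
  (same_letter_eval x E).
have LE u v lu lv : sphere_relation s q u v ->
    L u = lu -> L v = lv -> lu = lv -> L u = L v.
  by move=> _ -> ->.
move=> _ _ [x|x|x|x|x|x|x|x y e f g h]; last first.
  have [x' ->] := letter x; have [y' ->] := letter y.
  have [[e' ->] [f' ->]] := (index e, index f).
  have [[g' ->] [h' ->]] := (index g, index h).
  move=> ltxy; rewrite cross_rhsE // -word_elt2 L_word.
  have E : sphere_rule (y', e', f') (x', g', h') =
      Some (relabel_rule x' y' (cross_rule e' f' g' h')).
    by move: ltxy => /= ltxy; rewrite ltxy; case: eqP ltxy => // ->; rewrite ltnn.
  rewrite (Lr _ _ _ E) /eval linear_sum; apply: eq_bigr => i _; apply/esym/L_scale/L_word.
all: have [{}x ->] := letter x; have A := L_gen x false false;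
  have B := L_gen x false true; have C := L_gen x true false;
  have D := L_gen x true true.
- refine (LE _ _ _ _ (rel_11_22 s q (letter_of x))
    (A true true) (L_add L_one (L_scale _ (B true false))) _).
  rewrite (LR x false true true false _ erefl) /= -scalerBr scalerA.
  by rewrite mulfV ?expf_neq0 // scale1r addrC subrK.
- exact (LE _ _ _ _ (rel_22_21 s q (letter_of x))
    (D true false) (L_scale _ (C true true))
    (LR x true true true false _ erefl)).
- exact (LE _ _ _ _ (rel_22_12 s q (letter_of x))
    (D false true) (L_scale _ (B true true))
    (LR x true true false true _ erefl)).
- exact (LE _ _ _ _ (rel_22_11 s q (letter_of x))
    (D false false) (A true true) (LR x true true false false _ erefl)).
- refine (LE _ _ _ _ (rel_21_12 s q (letter_of x))
    (C false true)
    (L_add (B true false) (L_scale _ (L_sub (A true true) (D true true)))) _).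
  by rewrite (LR x true false false true _ erefl) (LR x false true true false _ erefl).
- exact (LE _ _ _ _ (rel_21_11 s q (letter_of x))
    (C false false) (L_sub (A true false) (L_scale _ (C true true)))
    (LR x true false false false _ erefl)).
- exact (LE _ _ _ _ (rel_12_11 s q (letter_of x))
    (B false false) (L_add (A false true) (L_scale _ (B true true)))
    (LR x false true false false _ erefl)).
Qed.

End Functional.

(** * Linear maps on the free algebra and the normal form operator *)

Definition pack_linear (V : lmodType K) (L : F -> V) (L_linear : linear L) :
    {linear F -> V} :=
  HB.pack L (GRing.isLinear.Build K F V *:%R L L_linear).

Lemma free_algebra_expand (g : F) :
  g = \sum_(m <- msupp g) g@_m *: word_elt (map encode m).
Proof.
rewrite {1}[g]monalgE; apply: eq_bigr => m _.
rewrite /word_elt (mapK encodeK) fmK; apply/malgP => k.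
apply: etrans (mcoeffU _ _ _) (esym (etrans (mcoeffZ _ _ _) _)).
by rewrite mcoeffU1 mulr_natr.
Qed.

Lemma linear_eq0 (V : lmodType K) (L : F -> V) : linear L ->
  (forall w, L (word_elt w) = 0) -> forall g, L g = 0.
Proof.
move=> L_linear L0 g; pose L' := pack_linear L_linear.
rewrite -[L g]/(L' g) [g]free_algebra_expand linear_sum big1 // => m _.
by apply: etrans (linearZ_LR L' _ _) _; rewrite /= L0 scaler0.
Qed.

Lemma linear_ext (V : lmodType K) (L1 L2 : F -> V) : linear L1 -> linear L2 ->
  (forall w, L1 (word_elt w) = L2 (word_elt w)) -> L1 =1 L2.
Proof.
move=> lin1 lin2 eqL g; apply/eqP; rewrite -subr_eq0; apply/eqP.
apply: (linear_eq0 (L := fun g => L1 g - L2 g)) => [c u v|w].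
  by rewrite lin1 lin2 opprD addrACA scalerBr.
by rewrite eqL subrr.
Qed.

(** Irreducible words are sent to themselves in the free algebra, so the operator is a candidate
    projection onto their span with the ideal as kernel. *)
Definition nf (w : seq code) : F := normal_form val sphere_rule word_measure word_elt w.

Lemma nf_respects : respects val sphere_rule (fun=> True) nf.
Proof.
apply: normal_form_respects; first exact: sphere_rule_smaller.
exact: sphere_overlaps_resolvable.
Qed.

Definition nf_lin : F -> F :=
  mmap (in_alg F) (fun m : {fmonom sphere_index} => nf (map encode m)).

Lemma nf_lin_linear : linear nf_lin.
Proof.
move=> c u v; rewrite /nf_lin mmapD; congr (_ + _).
rewrite (mmapEw (msuppZ_le c u)) mmapE scaler_sumr; apply: eq_bigr => m _.
apply: etrans (mulr_algl _ _) (etrans _ (congr1 ( *:%R c) (esym (mulr_algl _ _)))).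
exact: etrans (congr1 (fun k => k *: _) (mcoeffZ c u m)) (esym (scalerA _ _ _)).
Qed.

Lemma nf_lin_word w : nf_lin (word_elt w) = nf w.
Proof. by rewrite /nf_lin mmapU /= scale1r mul1r (mapK decodeK). Qed.

Lemma nf_lin_context u w : linear (fun g => nf_lin (word_elt u * g * word_elt w)).
Proof.
move=> c g h; rewrite mulrDr mulrDl -scalerAr -scalerAl.
exact: nf_lin_linear.
Qed.

(** The factors [x] and [y] strengthen the induction so that it passes through left and right
    multiplication. For a single relation, linearity reduces both factors to words, where
    [nf_respects] applies. *)
Lemma nf_lin_ideal g : ideal_gen (sphere_relation s q) g ->
  forall x y, nf_lin (x * g * y) = 0.
Proof.
elim=> {g} [g h rgh||g h _ IHg _ IHh|a g _ IHg|g a _ IHg] x y.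
- apply: (linear_eq0 (L := fun x => nf_lin (x * (g - h) * y))).
    move=> c u v; rewrite !mulrDl -!scalerAl; exact: nf_lin_linear.
  move=> u; apply: (linear_eq0 (L := fun y => nf_lin (word_elt u * (g - h) * y))).
    move=> c v w; rewrite mulrDr -scalerAr; exact: nf_lin_linear.
  move=> w; pose L := pack_linear (nf_lin_context u w).
  rewrite -[LHS]/(L (g - h)) raddfB; apply/eqP; rewrite subr_eq0; apply/eqP.
  have L_word v : L (word_elt v) = nf (u ++ v ++ w).
    by rewrite /= -!word_elt_cat nf_lin_word -catA.
  apply: (rules_relations L_word) rgh => a b r rab.
  exact: nf_respects rab I.
- by rewrite mulr0 mul0r; exact: raddf0 (pack_linear nf_lin_linear).
- rewrite mulrDr mulrDl; apply: etrans (raddfD (pack_linear nf_lin_linear) _ _) _.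
  exact: etrans (congr2 +%R (IHg x y) (IHh x y)) (addr0 0).
- by rewrite mulrA IHg.
- by rewrite mulrA -mulrA IHg.
Qed.

(** * Normal forms and the projection to the sphere algebra *)

Lemma quot_proj_linear : linear (quot_proj (sphere_relation s q) : F -> A).
Proof.
move=> c u v; apply: etrans (raddfD (quot_proj (sphere_relation s q)) _ _) _.
exact (congr1 (fun x => x + _) (quot_projZ (sphere_relation s q) c u)).
Qed.

Definition word_proj (w : seq code) : A := quot_proj (sphere_relation s q) (word_elt w).

Lemma word_proj_cat u v : word_proj (u ++ v) = word_proj u * word_proj v.
Proof.
rewrite /word_proj word_elt_cat; exact (quot_projM _ _ _).
Qed.

Lemma word_proj_nseq x i j n : word_proj (nseq n (x, i, j)) =
  sphere_elt s q (letter_of x) (index_of i) (index_of j) ^+ n.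
Proof.
elim: n => [|n IHn]; first by rewrite /word_proj word_elt_nil.
have E : word_proj [:: (x, i, j)] =
    sphere_elt s q (letter_of x) (index_of i) (index_of j).
  by rewrite /word_proj word_elt1.
exact (etrans (word_proj_cat [:: _] (nseq n _))
  (etrans (congr2 *%R E IHn) (esym (exprS _ _)))).
Qed.

Lemma word_proj_respects : respects val sphere_rule (fun=> True) word_proj.
Proof.
move=> u a b v r rab _.
pose L := @pack_linear A _ quot_proj_linear.
have Lrel : satisfies_relations L by move=> x y rxy; apply/quot_projP/ideal_rel.
have E := relations_rules (L := L) (LW := word_proj) (fun=> erefl) Lrel rab.
rewrite -cat1s -[[:: b & v]]cat1s -[u ++ _]/(u ++ [:: a; b] ++ v) !word_proj_cat E.
rewrite /eval mulr_suml mulr_sumr; apply: eq_bigr => t _.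
rewrite !word_proj_cat.
exact: etrans (congr1 ( *%R _) (esym (quot_scalerAl _ _ _)))
  (esym (quot_scalerAr _ _ _)).
Qed.

Lemma quot_proj_nf w : quot_proj (sphere_relation s q) (nf w) = word_proj w.
Proof.
apply: (normal_form_morph sphere_rule_smaller
  (L := @pack_linear A _ quot_proj_linear)) => //.
exact: word_proj_respects.
Qed.

Lemma quot_proj_nf_lin g : quot_proj (sphere_relation s q) (nf_lin g) =
  quot_proj (sphere_relation s q) g.
Proof.
apply: (@linear_ext A (fun g => quot_proj (sphere_relation s q) (nf_lin g))
  (quot_proj (sphere_relation s q)) _ quot_proj_linear) => [c u v|w].
  by rewrite nf_lin_linear; exact: quot_proj_linear.
by rewrite nf_lin_word; exact: quot_proj_nf.
Qed.

(** By linearity it suffices to treat words, by induction along reduction: an irreducible word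
    differs from the reducible word [m], so its coefficient at [m] is 0. *)
Lemma nf_support (m : {fmonom sphere_index}) g :
  ~~ sorted (irreducible sphere_rule) (map encode m) -> (nf_lin g)@_m = 0.
Proof.
move=> m_red; apply: (linear_eq0 (V := K^o) (L := fun g => (nf_lin g)@_m)).
  move=> c u v; rewrite nf_lin_linear.
  by apply: etrans (mcoeffD _ _ _) _; congr (_ + _); exact: mcoeffZ.
move=> w; rewrite nf_lin_word.
apply: (normal_form_ind sphere_rule_smaller (P := fun _ (x : F) => x@_m = 0)).
  move=> v redv; rewrite /word_elt mcoeffU1; case: eqP => // Em.
  by move: m_red; rewrite -Em /= (mapK decodeK) sorted_irreducible redv.
move=> v u r r' _ IH; apply: etrans (raddf_sum (mcoeff m) _ _ _) _.
apply: big1_seq => t /andP[_ tr].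
exact (etrans (mcoeffZ _ _ _) (etrans (congr1 ( *%R _) (IH t tr)) (mulr0 _))).
Qed.

(** * PBW monomials as the irreducible words *)

Definition pbw_word (m : {ffun sphere_index -> nat}) : seq code :=
  flatten [seq nseq (m (decode a)) a | a <- codes].

Definition exponent (w : seq code) : {ffun sphere_index -> nat} :=
  [ffun x => count_mem (encode x) w].

Lemma pbw_wordK : cancel pbw_word exponent.
Proof.
move=> m; apply/ffunP => x; rewrite ffunE -{2}[x]encodeK.
by move: (encode x) => [[[[]|] []] []];
  rewrite /pbw_word /= !count_cat !count_nseq /= ?mul1n ?mul0n ?addn0.
Qed.

(** The list [codes] runs through the generators in the order of the factors of a PBW monomial. *)
Lemma pbw_monomialE m : pbw_monomial s q m = word_proj (pbw_word m).
Proof.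
have prod_letters (G : 'I_3 -> A) : \prod_(x < 3) G x =
    G (letter_of None) * (G (letter_of (Some false)) * G (letter_of (Some true))).
  rewrite !big_ord_recl big_ord0 mulr1.
  by congr (G _ * (G _ * G _)); apply: val_inj.
have cat4 a b c d : word_proj (a ++ b ++ c ++ d ++ [::]) =
    word_proj a * word_proj b * word_proj c * word_proj d.
  rewrite cats0 (word_proj_cat a) (word_proj_cat b) (word_proj_cat c).
  exact (etrans (mulrA _ _ _) (mulrA _ _ _)).
have block x : sphere_elt s q (letter_of x) idx1 idx1 ^+ m (letter_of x, idx1, idx1) *
    sphere_elt s q (letter_of x) idx1 idx2 ^+ m (letter_of x, idx1, idx2) *
    sphere_elt s q (letter_of x) idx2 idx1 ^+ m (letter_of x, idx2, idx1) *
    sphere_elt s q (letter_of x) idx2 idx2 ^+ m (letter_of x, idx2, idx2) =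
    word_proj (flatten [seq nseq (m (decode a)) a | a <-
      [:: (x, false, false); (x, false, true); (x, true, false); (x, true, true)]]).
  exact (esym (etrans (cat4 _ _ _ _) (congr2 *%R (congr2 *%R (congr2 *%R
    (word_proj_nseq x false false _) (word_proj_nseq x false true _))
    (word_proj_nseq x true false _)) (word_proj_nseq x true true _)))).
rewrite /pbw_monomial prod_letters.
apply: etrans (congr2 *%R (block _) (congr2 *%R (block _) (block _))) _.
apply: etrans (congr1 ( *%R _) (esym (word_proj_cat _ _))) _.
by apply: etrans (esym (word_proj_cat _ _)) _; rewrite -!flatten_cat -!map_cat.
Qed.

Notation irr := (irreducible sphere_rule).

(** On the codes, [irr] is a partial order in which only [x^1_2] and [x^2_1] of the same letter are
    incomparable. Transitivity extends the condition on neighbours to all pairs in a word. *)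
Lemma irr_trans : transitive irr.
Proof.
have chk : all (fun b => all (fun a => all (fun c =>
    irr a b ==> irr b c ==> irr a c) codes) codes) codes by vm_compute.
move=> b a c; move/allP/(_ b (mem_codes b)): chk.
move/allP/(_ a (mem_codes a))/allP/(_ c (mem_codes c)).
by move=> /implyP H /H/implyP.
Qed.

Lemma irr_anti : antisymmetric irr.
Proof.
have chk : all (fun a => all (fun b =>
    irr a b && irr b a ==> (a == b)) codes) codes by vm_compute.
move=> a b; move/allP/(_ a (mem_codes a)): chk.
by move/allP/(_ b (mem_codes b))/implyP => H /H/eqP.
Qed.

Lemma pairwise_flatten_nseq (T : eqType) (r : rel T) (n : T -> nat) (l : seq T) :
  reflexive r -> pairwise (fun a b => [|| n a == 0, n b == 0 | r a b]%N) l ->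
  pairwise r (flatten [seq nseq (n a) a | a <- l]).
Proof.
move=> r_refl; elim: l => //= a l IHl /andP[/allP al /IHl pl].
rewrite pairwise_cat pl andbT; apply/andP; split.
  apply/allrelP => x y /nseqP[-> na] /flatten_mapP[b /al rab /nseqP[-> nb]].
  by case: (n a) (n b) na nb rab => [|?] [|?].
elim: (n a) => //= k ->; rewrite andbT; apply/allP => x /nseqP[-> _].
exact: r_refl.
Qed.

Lemma pairwise_mem (T : eqType) (r : rel T) (l : seq T) a b :
  pairwise r l -> a \in l -> b \in l -> a != b -> r a b || r b a.
Proof.
elim: l => //= c l IHl /andP[/allP rc /IHl{}IHl].
rewrite !inE => /predU1P[->|al] /predU1P[->|bl]; rewrite ?eqxx //.
- by rewrite rc.
- by rewrite rc // orbT.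
- exact: IHl.
Qed.

Lemma sorted_pbw_word m : m \in pbw_exponent -> sorted irr (pbw_word m).
Proof.
move=> /forallP mD; apply: pairwise_sorted; apply: pairwise_flatten_nseq.
  by move=> [[[[]|] []] []].
(* The sole exception to [irr] along [codes] is [x^1_2] before [x^2_1]; there the exponent condition
   makes one of the two blocks empty. *)
have chk : pairwise (fun a b => irr a b ||
   [&& a.1.1 == b.1.1, a.1.2 == false, a.2, b.1.2 & b.2 == false]) codes by vm_compute.
apply: sub_pairwise chk => -[[x i] j] [[y k] l] /orP[->|/=]; first by rewrite !orbT.
case/and5P => /eqP<- /eqP-> -> -> /eqP->; have := mD (letter_of x).
by rewrite orbA => ->.
Qed.

(** A sorted word is pairwise comparable, so it cannot contain both [x^1_2] and [x^2_1]. *)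
Lemma exponent_pbw w : sorted irr w -> exponent w \in pbw_exponent.
Proof.
rewrite sorted_pairwise; last exact: irr_trans.
move=> w_irr; apply/forallP => x; rewrite !ffunE !eqn0Ngt -!has_count !has_pred1.
rewrite -negb_and; apply/negP => /andP[wB wC].
have := pairwise_mem w_irr wB wC.
have -> : x = letter_of (encode (x, idx1, idx1)).1.1.
  by have := encodeK (x, idx1, idx1) => -[].
by case: (encode _).1.1 => [[]|] /(_ isT).
Qed.

(** Both words are sorted for a partial order and have the same letter counts, hence they are
    equal. *)
Lemma exponentK w : sorted irr w -> pbw_word (exponent w) = w.
Proof.
move=> w_irr; apply: (sorted_eq irr_trans irr_anti) => //.
  exact/sorted_pbw_word/exponent_pbw.
apply/allP => a _ /=.
have := congr1 (fun m : {ffun _ -> _} => m (decode a)) (pbw_wordK (exponent w)).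
by rewrite !ffunE decodeK => ->.
Qed.

Lemma pbw_basis : is_basis pbw_exponent (pbw_monomial s q).
Proof.
split=> [l c l_uniq lD sum0 j jl|u].
  (* A linear dependence lifts to an element [g] of the ideal, which [nf_lin] both kills and fixes.
     So [g] is 0 in the free algebra, where distinct words are independent. *)
  pose g : F := \sum_(i <- l) c i *: word_elt (pbw_word i).
  have g_ideal : ideal_gen (sphere_relation s q) g.
    rewrite -[g]subr0; apply/quot_projP; rewrite raddf0 -sum0.
    rewrite raddf_sum; apply: eq_bigr => i _; rewrite pbw_monomialE.
    exact: quot_projZ.
  have g0 : nf_lin g = 0.
    by have := nf_lin_ideal g_ideal 1 1; rewrite mul1r mulr1.
  have nf_g : nf_lin g = g.
    apply: etrans (linear_sum (pack_linear nf_lin_linear) _ _ _) _.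
    apply: eq_big_seq => i il.
    apply: etrans (linearZ_LR (pack_linear nf_lin_linear) _ _) _.
    apply: (congr1 ( *:%R (c i))); apply: etrans (nf_lin_word _) _.
    apply: normal_form_irreducible; have := sorted_pbw_word (lD i il).
    by rewrite sorted_irreducible; case: redex.
  have := congr1 (mcoeff (FMonom (map decode (pbw_word j)))) (etrans (esym nf_g) g0).
  rewrite mcoeff0 => <-; apply/esym; apply: etrans (raddf_sum (mcoeff _) _ _ _) _.
  rewrite (bigD1_seq j) //= [X in _ + X]big1 ?addr0 => [|i i_neq].
    by apply: etrans (mcoeffZ _ _ _) _; rewrite /word_elt mcoeffU1 eqxx mulr1.
  apply: etrans (mcoeffZ _ _ _) _; rewrite /word_elt mcoeffU1.
  case: eqP => [[] /(inj_map (can_inj decodeK))/(can_inj pbw_wordK) E|_].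
    by rewrite E eqxx in i_neq.
  by rewrite mulr0.
(* For spanning, [u] is represented by a normal form, all of whose words are irreducible and hence
   PBW words. *)
pose h : F := nf_lin (repr u).
have h_irr m : m \in msupp h -> sorted irr (map encode m).
  rewrite -mcoeff_neq0; apply: contra_neqT; exact: nf_support.
exists [seq exponent (map encode (m : {fmonom sphere_index})) | m <- msupp h].
exists (fun i => h@_(FMonom (map decode (pbw_word i)))); split.
  by move=> i /mapP[m /h_irr m_irr ->]; apply: exponent_pbw.
rewrite big_map -[LHS](quot_projK u) -quot_proj_nf_lin -/h {1}[h]free_algebra_expand.
rewrite raddf_sum; apply: eq_big_seq => m /h_irr m_irr.
have E : FMonom (map decode (pbw_word (exponent (map encode m)))) = m.
  by rewrite exponentK // (mapK encodeK) fmK.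
exact (etrans (quot_projZ _ _ _) (congr2 (fun k x => k *: x)
  (congr1 (fun k => h@_k) (esym E))
  (esym (etrans (pbw_monomialE _) (congr1 word_proj (exponentK m_irr)))))).
Qed.

End SphereAlgebra.

Local Open Scope complex_scope.

Theorem proposition2p7 (R : realType) (q s : R[i]) (hq : generic q)
    (hs : s ^+ 2 = q) :
  is_basis pbw_exponent (pbw_monomial s q).
Proof.
case: hq => q_neq0 _; rewrite -hs in q_neq0 *.
by apply: pbw_basis; move: q_neq0; rewrite expf_eq0.
Qed.
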